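(* Let $r\ge2$. Let $B^+(\infty,\infty,r)$ be the monoid defined by the generators $\{t_i\mid i\in\mathbb{Z}\}\cup S$, $S=\{s_3,\ldots,s_r\}$, and the relations: the usual braid relations on $S$; $t_it_{i-1}=t_jt_{j-1}$ for $i,j\in\mathbb{Z}$; $s_3t_is_3=t_is_3t_i$ for $i\in\mathbb{Z}$; $s_jt_i=t_is_j$ for $i\in\mathbb{Z}$ and $4\le j\le r$. Let $B(\infty,\infty,r)$ be the group defined by the same presentation. Then this presentation gives rise to a quasi-Garside structure on $B(\infty,\infty,r)$: $B^+(\infty,\infty,r)$ is a quasi-Garside monoid, with group of fractions $B(\infty,\infty,r)$, and $$\Lambda=(s_rs_{r-1}\cdots s_3\,t_1t_0)^{r-1}$$ is a Garside element of it.
   Context: The usual braid relations on $S=\{s_3,\ldots,s_r\}$ are $s_is_j=s_js_i$ for $|i-j|\ge 2$ and $s_is_{i+1}s_i=s_{i+1}s_is_{i+1}$ for $3\le i\le r-1$. If $r=2$ then $S=\emptyset$, all relations involving some $s_j$ are absent, and $s_r\cdots s_3$ is the empty product. A monoid $M$ is quasi-Garside if: (1) $M$ is atomic, i.e. for every $m\in M$ the number of (nontrivial) factors in a product equal to $m$ is bounded; (2) $M$ is left- and right-cancellative; (3) $M$ is a lattice with respect to each of the orders defined by left divisibility and by right divisibility; (4) $M$ has a Garside element $\Delta$, i.e. an element whose set of left divisors equals its set of right divisors, this set generating $M$. A quasi-Garside monoid satisfies Ore's conditions and so embeds in its group of fractions $G$; the pair $(M,\Delta)$ is called a quasi-Garside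 structure on $G$. *)

(* Defs.v *)
From HB Require Import structures.
From mathcomp Require Import all_boot all_order all_algebra.
From mathcomp Require Import boolp.

Set Implicit Arguments.
Unset Strict Implicit.
Unset Printing Implicit Defensive.

Local Open Scope group_scope.
Local Open Scope quotient_scope.

(** * Monoids and groups given by generators and relations *)

(* The relations [R u v] are read as equations [u = v] between words. *)
Inductive word_congr (X : Type) (R : seq X -> seq X -> Prop) :
    seq X -> seq X -> Prop :=
| congr_rel u v : R u v -> word_congr R u v
| congr_refl u : word_congr R u u
| congr_sym u v : word_congr R u v -> word_congr R v u
| congr_trans u v w : word_congr R u v -> word_congr R v w -> word_congr R u w
| congr_cat u u' v v' : word_congr R u u' -> word_congr R v v' ->
    word_congr R (u ++ v) (u' ++ v').

Section PresentedMonoid.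
Variables (X : choiceType) (R : seq X -> seq X -> Prop).

Definition word_congrb : rel (seq X) := fun u v => `[< word_congr R u v >].

Lemma word_congrb_refl : reflexive word_congrb.
Proof. by move=> u; apply/asboolP; apply: congr_refl. Qed.

Lemma word_congrb_sym : symmetric word_congrb.
Proof.
by move=> u v; apply/idP/idP => /asboolP uv; apply/asboolP; apply: congr_sym.
Qed.

Lemma word_congrb_trans : transitive word_congrb.
Proof.
move=> v u w /asboolP uv /asboolP vw.
by apply/asboolP; apply: congr_trans uv vw.
Qed.

Canonical word_congrb_equiv :=
  EquivRel word_congrb word_congrb_refl word_congrb_sym word_congrb_trans.

Definition presented_monoid := {eq_quot word_congrb}.

HB.instance Definition _ := Choice.on presented_monoid.
HB.instance Definition _ := Quotient.on presented_monoid.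

Definition word_class (u : seq X) : presented_monoid :=
  \pi_presented_monoid u.

Lemma word_classP u v : word_class u = word_class v <-> word_congr R u v.
Proof.
split; first by move=> /eqmodP /asboolP.
by move=> uv; apply/eqmodP/asboolP.
Qed.

Definition pm_one : presented_monoid := word_class [::].
Definition pm_mul (a b : presented_monoid) : presented_monoid :=
  word_class (repr a ++ repr b).

Lemma word_class_repr a : word_class (repr a) = a.
Proof. exact: reprK. Qed.

Lemma congr_repr u : word_congr R (repr (word_class u)) u.
Proof. by apply/word_classP; rewrite word_class_repr. Qed.

Lemma pm_mulE u v :
  pm_mul (word_class u) (word_class v) = word_class (u ++ v).
Proof. by apply/word_classP; apply: congr_cat; apply: congr_repr. Qed.

Lemma pm_mulA : associative pm_mul.
Proof.
move=> a b c; rewrite -(word_class_repr a) -(word_class_repr b).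
by rewrite -(word_class_repr c) !pm_mulE catA.
Qed.

Lemma pm_mul1 : left_id pm_one pm_mul.
Proof. by move=> a; rewrite -(word_class_repr a) pm_mulE. Qed.

Lemma pm_mulr1 : right_id pm_one pm_mul.
Proof. by move=> a; rewrite -(word_class_repr a) pm_mulE cats0. Qed.

HB.instance Definition _ :=
  isMonoid.Build presented_monoid pm_mulA pm_mul1 pm_mulr1.

Definition monoid_gen (x : X) : presented_monoid := word_class [:: x].

End PresentedMonoid.

Section PresentedGroup.
Variables (X : choiceType) (R : seq X -> seq X -> Prop).

(* The letter [(x, false)] stands for x and [(x, true)] for its inverse. *)
Definition positive_word (u : seq X) : seq (X * bool) :=
  [seq (x, false) | x <- u].

Inductive group_rel : seq (X * bool) -> seq (X * bool) -> Prop :=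
| group_rel_pos u v : R u v -> group_rel (positive_word u) (positive_word v)
| group_rel_inv x e : group_rel [:: (x, e); (x, ~~ e)] [::].

Definition presented_group := presented_monoid group_rel.

HB.instance Definition _ := Monoid.on presented_group.

Definition inv_word (u : seq (X * bool)) : seq (X * bool) :=
  rev [seq (l.1, ~~ l.2) | l <- u].

Definition pg_inv (g : presented_group) : presented_group :=
  word_class group_rel (inv_word (repr g)).

HB.instance Definition _ := hasInv.Build presented_group pg_inv.

Lemma inv_wordK : involutive inv_word.
Proof.
move=> u; rewrite /inv_word map_rev revK -map_comp -[RHS]map_id.
by apply: eq_map => -[x e] /=; rewrite negbK.
Qed.

Lemma congr_mulV u : word_congr group_rel (u ++ inv_word u) [::].
Proof.
elim: u => [|[x e] u IHu]; first exact: congr_refl.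
have -> : ((x, e) :: u) ++ inv_word ((x, e) :: u) =
    [:: (x, e)] ++ (u ++ inv_word u) ++ [:: (x, ~~ e)].
  by rewrite /inv_word /= rev_cons -cats1 catA.
apply: (congr_trans (v := [:: (x, e)] ++ [::] ++ [:: (x, ~~ e)])).
  apply: congr_cat; first exact: congr_refl.
  by apply: congr_cat; last exact: congr_refl.
exact/congr_rel/group_rel_inv.
Qed.

Lemma congr_mulgV u : word_congr group_rel (inv_word u ++ u) [::].
Proof. by rewrite -{2}(inv_wordK u); apply: congr_mulV. Qed.

Lemma pg_mulV (g : presented_group) : pg_inv g * g = 1.
Proof.
rewrite -{2}(word_class_repr g) [LHS]pm_mulE.
by apply/word_classP; apply: congr_mulgV.
Qed.

Lemma pg_mulgV (g : presented_group) : g * pg_inv g = 1.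
Proof.
rewrite -{1}(word_class_repr g) [LHS]pm_mulE.
by apply/word_classP; apply: congr_mulV.
Qed.

HB.instance Definition _ :=
  Monoid_isGroup.Build presented_group pg_mulV pg_mulgV.

(* The canonical morphism, which sends each generator to itself; by
   [monoid_to_groupE] it does not depend on the chosen representative. *)
Definition monoid_to_group (m : presented_monoid R) : presented_group :=
  word_class group_rel (positive_word (repr m)).

Lemma monoid_to_groupE u :
  monoid_to_group (word_class R u) = word_class group_rel (positive_word u).
Proof.
apply/word_classP.
move: (repr _) (congr_repr R u) => w; elim => {u w}.
- by move=> u v Ruv; apply: congr_rel; apply: group_rel_pos.
- by move=> u; apply: congr_refl.
- by move=> u v _; apply: congr_sym.
- by move=> u v w _ uv _ vw; apply: congr_trans uv vw.
- move=> u u' v v' _ uu' _ vv'.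
  by rewrite /positive_word !map_cat; apply: congr_cat.
Qed.

End PresentedGroup.

(** * Quasi-Garside monoids *)

Section QuasiGarside.
Variable M : monoidType.

Definition left_divides (a b : M) : Prop := exists c, b = a * c.
Definition right_divides (a b : M) : Prop := exists c, b = c * a.

Definition atomic_monoid : Prop :=
  forall m : M, exists n : nat, forall s : seq M,
    (forall x, x \in s -> x <> 1) -> \prod_(x <- s) x = m -> size s <= n.

Definition cancellative : Prop :=
  (forall a b c : M, a * b = a * c -> b = c) /\
  (forall a b c : M, b * a = c * a -> b = c).

Definition is_meet (T : Type) (le : T -> T -> Prop) (x y m : T) : Prop :=
  [/\ le m x, le m y & forall z, le z x -> le z y -> le z m].

Definition is_join (T : Type) (le : T -> T -> Prop) (x y j : T) : Prop :=
  [/\ le x j, le y j & forall z, le x z -> le y z -> le j z].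

Definition lattice_order (T : Type) (le : T -> T -> Prop) : Prop :=
  [/\ (forall x, le x x),
      (forall x y, le x y -> le y x -> x = y),
      (forall x y z, le x y -> le y z -> le x z),
      (forall x y, exists m, is_meet le x y m)
    & (forall x y, exists j, is_join le x y j)].

Definition garside_element (D : M) : Prop :=
  (forall a, left_divides a D <-> right_divides a D) /\
  (forall m : M, exists s : seq M,
     (forall x, x \in s -> left_divides x D) /\ m = \prod_(x <- s) x).

Definition quasi_garside_monoid : Prop :=
  [/\ atomic_monoid, cancellative, lattice_order left_divides,
      lattice_order right_divides & exists D : M, garside_element D].

(* For a cancellative monoid satisfying both Ore conditions, this determines
   the pair (G, f) up to a unique isomorphism. *)
Definition is_group_of_fractions (G : groupType) (f : M -> G) : Prop :=
  [/\ f 1 = 1 /\ (forall a b, f (a * b) = f a * f b),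
      injective f,
      (forall g, exists a b, g = f a * (f b)^-1)
    & (forall g, exists a b, g = (f a)^-1 * f b)].

End QuasiGarside.

(** * The presentation of B(oo, oo, r) *)

Definition B_gen (r : nat) : choiceType := (int + 'I_(r - 2))%type.

Definition tgen (r : nat) (i : int) : B_gen r := inl i.

(* The letter [sgen k] is the generator written s_(k+3), so that [k : 'I_(r-2)]
   runs through s_3, ..., s_r. *)
Definition sgen (r : nat) (k : 'I_(r - 2)) : B_gen r := inr k.
Definition s_index (r : nat) (k : 'I_(r - 2)) : nat := k + 3.

Inductive B_rel (r : nat) : seq (B_gen r) -> seq (B_gen r) -> Prop :=
| rel_ss_comm (k l : 'I_(r - 2)) :
    (s_index k + 2 <= s_index l) || (s_index l + 2 <= s_index k) ->
    B_rel [:: sgen k; sgen l] [:: sgen l; sgen k]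
| rel_ss_braid (k l : 'I_(r - 2)) : s_index l = (s_index k).+1 ->
    B_rel [:: sgen k; sgen l; sgen k] [:: sgen l; sgen k; sgen l]
| rel_tt (i j : int) :
    B_rel [:: tgen r i; tgen r (i - 1)%R] [:: tgen r j; tgen r (j - 1)%R]
| rel_s3t (k : 'I_(r - 2)) (i : int) : s_index k = 3 ->
    B_rel [:: sgen k; tgen r i; sgen k] [:: tgen r i; sgen k; tgen r i]
| rel_st (k : 'I_(r - 2)) (i : int) : 4 <= s_index k ->
    B_rel [:: sgen k; tgen r i] [:: tgen r i; sgen k].

Definition Bplus (r : nat) : monoidType := presented_monoid (@B_rel r).
Definition B (r : nat) : groupType := presented_group (@B_rel r).

Definition Bplus_to_B (r : nat) : Bplus r -> B r :=
  @monoid_to_group _ (@B_rel r).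

Definition t_ (r : nat) (i : int) : Bplus r := monoid_gen (@B_rel r) (tgen r i).
Definition s_ (r : nat) (k : 'I_(r - 2)) : Bplus r :=
  monoid_gen (@B_rel r) (sgen k).

(* [rev_ord] makes the product run in the order s_r, s_(r-1), ..., s_3. *)
Definition Lambda (r : nat) : Bplus r :=
  ((\prod_(k < r - 2) s_ (rev_ord k)) * t_ r 1%R * t_ r 0%R) ^+ (r - 1).

(* Main.v *)
(* For generators x, y of the monoid write x\y for the complement such that
   x (x\y) = y (y\x) is their defining common multiple. The main point is that
   x a = y b forces a = (x\y) w and b = (y\x) w for some w: by induction on the
   length, the relation between (x, a) and (y, b) which this expresses is
   transitive, by Garside's check on triples of generators, and therefore
   contains the congruence. Left cancellation and lcms of elements with a common
   multiple follow, and the anti-automorphism t_i -> t_(-i), s_k -> s_k gives the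
   right-hand versions.

   Write tau = t_i t_(i-1). Then tau, s_3, ..., s_r satisfy the relations of type
   B_(r-1), and Lambda is the product of the commuting elements tau,
   s_3 tau s_3, s_4 s_3 tau s_3 s_4, ... Each t_i passes through tau with a shift
   of its index by 2 and through the other factors with a shift by 1, so
   t_i Lambda = Lambda t_(i-r), while the s_k commute with Lambda. Hence Lambda is
   quasi-central and divisible by all generators. *)

Require Import Defs.
From mathcomp Require Import all_boot.
From mathcomp Require Import ssralg ssrint ssrnum boolp zify.

Set Implicit Arguments.
Unset Strict Implicit.
Unset Printing Implicit Defensive.

(** * Word length and atomicity *)

Section WordLength.
Local Open Scope group_scope.
Variable r : nat.
Implicit Types (x y z : B_gen r) (a b c : Bplus r) (u v w : seq (B_gen r)).

Definition bgen x : Bplus r := monoid_gen (@B_rel r) x.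
Definition bword u : Bplus r := word_class (@B_rel r) u.

Lemma bword_cat u v : bword (u ++ v) = bword u * bword v.
Proof. by rewrite /bword -pm_mulE. Qed.

Lemma bword_cons x u : bword (x :: u) = bgen x * bword u.
Proof. exact: (bword_cat [:: x] u). Qed.

Lemma bword_repr a : bword (repr a) = a.
Proof. exact: word_class_repr. Qed.

Lemma bplus_ind (P : Bplus r -> Prop) :
  P 1 -> (forall x a, P a -> P (bgen x * a)) -> forall a, P a.
Proof.
move=> P1 PM a; rewrite -(bword_repr a).
by elim: (repr a) => [|x u IHu] //; rewrite bword_cons; apply: PM.
Qed.

Lemma bplus_case a : a = 1 \/ exists x b, a = bgen x * b.
Proof. by elim/bplus_ind: a => [|x a _]; [left | right; exists x, a]. Qed.

Lemma B_rel_size u v : B_rel u v -> size u = size v.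
Proof. by case. Qed.

Lemma B_congr_size u v : word_congr (@B_rel r) u v -> size u = size v.
Proof.
elim=> {u v} //.
- exact: B_rel_size.
- by move=> u v w _ -> _ ->.
- by move=> u u' v v' _ uu' _ vv'; rewrite !size_cat uu' vv'.
Qed.

(** The relations are homogeneous, so every representative gives the same length. *)
Definition blen a : nat := size (repr a).

Lemma blen_word u : blen (bword u) = size u.
Proof. exact/B_congr_size/congr_repr. Qed.

Lemma blenM a b : blen (a * b) = blen a + blen b.
Proof.
by rewrite -(bword_repr a) -(bword_repr b) -bword_cat !blen_word size_cat.
Qed.

Lemma blen1 : blen 1 = 0.
Proof. exact: (blen_word [::]). Qed.

Lemma blen_gen x : blen (bgen x) = 1%N.
Proof. exact: (blen_word [:: x]). Qed.

Lemma blen_eq0 a : blen a = 0 -> a = 1.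
Proof. by rewrite -{2}(bword_repr a) /blen; case: (repr a). Qed.

Definition blenE := (blenM, blen_gen, blen1).

Lemma bplus_atomic : atomic_monoid (Bplus r).
Proof.
move=> m; exists (blen m) => s + <- {m}; elim: s => [|x s IHs] sN1 //.
rewrite big_cons blenM /= -addn1 addnC leq_add //.
  rewrite lt0n; apply/eqP=> /blen_eq0; apply: sN1; exact: mem_head.
by apply: IHs => y ys; apply: sN1; rewrite inE ys orbT.
Qed.

End WordLength.

(** * Complements of pairs of generators *)

Section Complement.
Local Open Scope group_scope.
Variable r : nat.
Implicit Types (x y z : B_gen r) (a b c v w : Bplus r).

Local Notation g := (@bgen r).
Local Notation t i := (bgen (tgen r i)).

(* Rank of a generator in the Dynkin diagram: all [t_i] sit at the vertex 0,
   next to [s_3]. *)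
Definition vertex x : nat := match x with inl _ => 0 | inr k => k.+1 end.

Definition adjacent x y :=
  (vertex x == (vertex y).+1) || (vertex y == (vertex x).+1).
Definition distant x y :=
  ((vertex x).+1 < vertex y) || ((vertex y).+1 < vertex x).

(** For distinct letters t_i, t_j the complement completes t_i to tau, whatever j is. The default 1
    of the last match is reached only when x = y is an [sgen] letter. *)
Definition compl x y : Bplus r :=
  if adjacent x y then g y * g x else
  if distant x y then g y else
  match x, y with
  | inl i, inl j => if i == j then 1 else t (i - 1)%R
  | _, _ => 1
  end.

Lemma adjacent_sym : symmetric adjacent.
Proof. by move=> x y; rewrite /adjacent orbC. Qed.

Lemma distant_sym : symmetric distant.
Proof. by move=> x y; rewrite /distant orbC. Qed.

Variant pair_spec x y : Prop :=
| PairEq of x = y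
| PairT i j of x = tgen r i & y = tgen r j & i <> j
| PairAdjacent of adjacent x y
| PairDistant of distant x y.

Lemma pairP x y : pair_spec x y.
Proof.
have [xy|Nxy] := boolP (adjacent x y); first exact: PairAdjacent.
have [xy|Dxy] := boolP (distant x y); first exact: PairDistant.
move: Nxy Dxy; rewrite /adjacent /distant; case: x y => [i|k] [j|l] /=.
- have [->|/eqP ij] := eqVneq i j; first by move=> *; apply: PairEq.
  by move=> *; apply: PairT ij.
- by lia.
- by lia.
- move=> A D; apply: PairEq; congr inr; apply/val_inj => /=; lia.
Qed.

Lemma compl_id x : compl x x = 1.
Proof.
have -> : compl x x = match x, x with
  | inl i, inl j => if i == j then 1 else t (i - 1)%R | _, _ => 1 end.
  by rewrite /compl /adjacent /distant !ifN //; lia.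
by case: x => // i; rewrite eqxx.
Qed.

Lemma compl_adjacent x y : adjacent x y -> compl x y = g y * g x.
Proof. by rewrite /compl => ->. Qed.

Lemma compl_distant x y : distant x y -> compl x y = g y.
Proof. by rewrite /compl /adjacent /distant => xy; rewrite xy ifN //; lia. Qed.

Lemma compl_adjacent_r x y : adjacent x y -> compl y x = g x * g y.
Proof. by rewrite adjacent_sym; apply: compl_adjacent. Qed.

Lemma compl_distant_r x y : distant x y -> compl y x = g x.
Proof. by rewrite distant_sym; apply: compl_distant. Qed.

Lemma compl_t i j : i <> j -> compl (tgen r i) (tgen r j) = t (i - 1)%R.
Proof. by move=> /eqP/negPf ij; rewrite /compl /= ij. Qed.

Lemma rel_bword (u v : seq (B_gen r)) : B_rel u v -> bword u = bword v.
Proof. by move=> uv; apply/word_classP/congr_rel. Qed.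

Lemma t_pair i j v : t i * (t (i - 1)%R * v) = t j * (t (j - 1)%R * v).
Proof.
rewrite !mulgA; congr (_ * v).
by have := rel_bword (rel_tt r i j); rewrite !bword_cons !mulg1.
Qed.

Definition btau : Bplus r := t 1%R * t 0%R.

Lemma btauE i v : t i * (t (i - 1)%R * v) = btau * v.
Proof. by rewrite (t_pair i 1%R) mulgA. Qed.

Lemma distantC x y v : distant x y -> g x * (g y * v) = g y * (g x * v).
Proof.
move=> xy; rewrite !mulgA; congr (_ * v).
have cons2 z z' : g z * g z' = bword [:: z; z'] by rewrite !bword_cons mulg1.
rewrite !cons2; case: x y xy => [i|k] [j|l]; rewrite /distant //=; last first.
- by move=> kl; apply/rel_bword/rel_ss_comm; rewrite /s_index; lia.
- by move=> kl; apply/rel_bword/rel_st; rewrite /s_index; lia.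
- by move=> kl; apply/esym/rel_bword/rel_st; rewrite /s_index; lia.
Qed.

Lemma adjacent_braid x y v : adjacent x y ->
  g x * (g y * (g x * v)) = g y * (g x * (g y * v)).
Proof.
move=> xy; rewrite !mulgA; congr (_ * v).
have cons3 z z' : g z * g z' * g z = bword [:: z; z'; z].
  by rewrite !bword_cons mulg1 mulgA.
rewrite !cons3; case: x y xy => [i|k] [j|l]; rewrite /adjacent //=.
- by move=> kl; apply/esym/rel_bword/rel_s3t; rewrite /s_index; lia.
- by move=> kl; apply/rel_bword/rel_s3t; rewrite /s_index; lia.
- case/orP=> kl; last by apply/rel_bword/rel_ss_braid; rewrite /s_index; lia.
  by apply/esym/rel_bword/rel_ss_braid; rewrite /s_index; lia.
Qed.

(** Write tau as t_i t_(i-1), then braid z with t_(i-1) and with t_i. This shift by one serves both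
    the cube condition and [t_jm]. *)
Lemma conj_btau_t z i v : adjacent z (tgen r i) ->
  g z * (btau * (g z * (t (i - 1)%R * v))) = t i * (g z * (btau * (g z * v))).
Proof.
(* All [tgen] letters share vertex 0, so adjacency to them is independent of the index by
   conversion. *)
move=> zt; have zt' : adjacent z (tgen r (i - 1)%R) by [].
by rewrite -(btauE i) -(adjacent_braid _ zt') (adjacent_braid _ zt) btauE.
Qed.

Lemma compl_lcm x y v : g x * (compl x y * v) = g y * (compl y x * v).
Proof.
case: (pairP x y) => [->|i j -> -> ij|xy|xy] //.
- by rewrite !compl_t //; [apply: t_pair | apply/nesym].
- by rewrite (compl_adjacent xy) (compl_adjacent_r xy) -!mulgA adjacent_braid.
- by rewrite (compl_distant xy) (compl_distant_r xy) distantC.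
Qed.

(* [factor x y a b] says that [x a] and [y b] are the same multiple of the lcm
   [x (x\y) = y (y\x)] of the generators [x] and [y]. *)
Definition factor x y a b :=
  exists w, a = compl x y * w /\ b = compl y x * w.

Lemma factor_sym x y a b : factor x y a b -> factor y x b a.
Proof. by case=> w [-> ->]; exists w. Qed.

Lemma factorMr x y a b c : factor x y a b -> factor x y (a * c) (b * c).
Proof. by case=> w [-> ->]; exists (w * c); rewrite !mulgA. Qed.

Lemma factor_refl x a : factor x x a a.
Proof. by exists a; rewrite compl_id mul1g. Qed.

End Complement.

(** * The cube condition on triples of generators *)

Section Cube.
Local Open Scope group_scope.
Variables (r n : nat).
Implicit Types (x y z : B_gen r) (a b c v w : Bplus r).

Local Notation g := (@bgen r).
Local Notation t i := (bgen (tgen r i)).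

(** This is the induction hypothesis of [congr_factor], available for shorter words. *)
Hypothesis factor_lt : forall x y a b,
  blen a < n -> g x * a = g y * b -> factor x y a b.

Let mulgI_lt x a b : blen a < n -> g x * a = g x * b -> a = b.
Proof. by move=> an /(factor_lt an)[w []]; rewrite compl_id mul1g => -> ->. Qed.

Let factor_distant x y a b : distant x y -> blen a < n -> g x * a = g y * b ->
  exists w, a = g y * w /\ b = g x * w.
Proof.
move=> xy an /(factor_lt an)[w []].
by rewrite (compl_distant xy) (compl_distant_r xy) => -> ->; exists w.
Qed.

Let factor_adjacent x y a b : adjacent x y -> blen a < n -> g x * a = g y * b ->
  exists w, a = g y * (g x * w) /\ b = g x * (g y * w).
Proof.
move=> xy an /(factor_lt an)[w []].
rewrite (compl_adjacent xy) (compl_adjacent_r xy) => -> ->.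
by exists w; rewrite !mulgA.
Qed.

Let factor_t i j a b : i <> j -> blen a < n -> t i * a = t j * b ->
  exists w, a = t (i - 1)%R * w /\ b = t (j - 1)%R * w.
Proof.
move=> ij an /(factor_lt an)[w []].
by rewrite !compl_t //; [move=> -> ->; exists w | apply/nesym].
Qed.

(** Transitivity of [factor] through the middle letter z, with both expressions of the common tail
    explicit. A tail of length n is allowed because [factor_lt] bounds what remains after its first
    letter. *)
Let cube x z y := forall w1 w2, blen (compl z x * w1) <= n ->
  compl z x * w1 = compl z y * w2 ->
  factor x y (compl x z * w1) (compl y z * w2).

Let cube_sym x z y : cube x z y -> cube y z x.
Proof.
by move=> C w1 w2 L E; apply/factor_sym/C => //; rewrite -E.
Qed.

Let cube_idl x y : cube x x y.
Proof.
by move=> w1 w2 _; rewrite compl_id mul1g => ->; exists w2.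
Qed.

(** Taking lengths of all equations in the context reduces the side conditions to linear
    arithmetic. *)
Ltac len_tac := by
  repeat match goal with
  | L : is_true (blen _ <= n) |- _ => move: L
  | E : @eq _ _ _ |- _ => move: {E} (congr1 (@blen r) E)
  end; rewrite ?blenE; lia.

Let cube_id x z : cube x z x.
Proof.
move=> w1 w2; case: (pairP z x) => [->|i j -> -> ij|zx|zx].
- by move=> _; rewrite !compl_id !mul1g => <-; apply: factor_refl.
- rewrite !compl_t //; last exact/nesym.
  by move=> L /mulgI_lt <-; [apply: factor_refl | len_tac].
- rewrite (compl_adjacent zx) (compl_adjacent_r zx) -!mulgA => L /mulgI_lt E.
  have /mulgI_lt <- : g z * w1 = g z * w2 by apply: E; len_tac.
    by apply: factor_refl.
  len_tac.
- rewrite (compl_distant zx) (compl_distant_r zx) => L /mulgI_lt <-.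
    exact: factor_refl.
  len_tac.
Qed.

(** Since z commutes with x and y, the factorisation for x and y merely acquires a factor z. *)
Let cube_distant2 x z y : distant x z -> distant z y -> cube x z y.
Proof.
move=> xz zy w1 w2.
rewrite (compl_distant zy) (compl_distant xz).
rewrite (compl_distant_r zy) (compl_distant_r xz).
have comm := fun v => distantC v xz.
have comm' := fun v => distantC v zy.
case: (pairP x y) => [<-|i j xi yj ij|xy|xy] L.
- by move=> /mulgI_lt <-; [apply: factor_refl | len_tac].
- rewrite {1}xi {1}yj; move=> /(factor_t ij)[|w [-> ->]]; first len_tac.
  exists (g z * w); rewrite xi yj (compl_t r ij) (compl_t r (nesym ij)).
  have zt l : distant z (tgen r l) by rewrite distant_sym; move: xz; rewrite xi.
  by split; rewrite distantC.
- move=> /(factor_adjacent xy)[|w [-> ->]]; first len_tac.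
  exists (g z * w); rewrite (compl_adjacent xy) (compl_adjacent_r xy) -!mulgA.
  by split; [rewrite comm' -comm | rewrite -comm comm'].
- move=> /(factor_distant xy)[|w [-> ->]]; first len_tac.
  exists (g z * w); rewrite (compl_distant xy) (compl_distant_r xy).
  by rewrite comm -comm'.
Qed.

Let cube_distant_adjacent x z y : distant x z -> adjacent z y -> cube x z y.
Proof.
move=> xz zy w1 w2.
rewrite (compl_adjacent zy) (compl_distant xz).
rewrite (compl_adjacent_r zy) (compl_distant_r xz) -!mulgA.
have xzC := fun v => distantC v xz.
have zyB := fun v => adjacent_braid v zy.
case: (pairP x y) => [xy|i j xi yj ij|xy|xy] L.
- by exfalso; move: xz zy; rewrite xy /distant /adjacent; lia.
- by exfalso; move: xz zy; rewrite xi yj /distant /adjacent /=; lia.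
- have xyB := fun v => adjacent_braid v xy.
  move=> /(factor_adjacent xy)[|v [Ew1 Ev]]; first len_tac.
  have [|v2 [Ev1 Ew2]] := factor_distant xz _ (esym Ev); first len_tac.
  have [|v3 [Ev3 Ev2]] := factor_adjacent zy _ (esym Ev1); first len_tac.
  (* Here x, y, z form a path of type A_3, and the witness completes x y x to the Garside element of
     that type, times v3. *)
  exists (g z * (g y * (g x * v3))).
  rewrite (compl_adjacent xy) (compl_adjacent_r xy) -!mulgA Ew1 Ew2 Ev3 Ev2.
  split.
    by rewrite xzC zyB -xyB -xzC.
  by rewrite -xyB -xzC (xzC v3) zyB.
- move=> /(factor_distant xy)[|v [Ew1 Ev]]; first len_tac.
  have [|v2 [Ev1 Ew2]] := factor_distant xz _ (esym Ev); first len_tac.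
  exists (g z * (g y * v2)).
  rewrite (compl_distant xy) (compl_distant_r xy) Ew1 Ew2 Ev1.
  have xyC := fun v => distantC v xy.
  by split; [rewrite zyB | rewrite -xyC -xzC].
Qed.

Let cube_adjacent2 x z y : adjacent x z -> adjacent z y -> cube x z y.
Proof.
move=> xz zy w1 w2.
rewrite (compl_adjacent zy) (compl_adjacent xz).
rewrite (compl_adjacent_r zy) (compl_adjacent_r xz) -!mulgA.
have xzB := fun v => adjacent_braid v xz.
have zyB := fun v => adjacent_braid v zy.
case: (pairP x y) => [<-|i j xi yj ij|xy|xy] L.
- move=> Ew; have E : g z * w1 = g z * w2 by apply: mulgI_lt Ew; len_tac.
  have <- : w1 = w2 by apply: mulgI_lt E; len_tac.
  exact: factor_refl.
- subst x y => /(factor_t ij)[|v [Ev1 Ev2]]; first len_tac.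
  have zt k : adjacent z (tgen r k) by rewrite adjacent_sym.
  have [|v1 [Ew1 Ev1']] := factor_adjacent (zt _) _ Ev1; first len_tac.
  have [|v2 [Ew2 Ev2']] := factor_adjacent (zt _) _ Ev2; first len_tac.
  have E : t (i - 1)%R * v1 = t (j - 1)%R * v2.
    by apply: mulgI_lt (etrans (esym Ev1') Ev2'); len_tac.
  have ij1 : (i - 1)%R <> (j - 1)%R by move=> /GRing.addIr.
  have [|v3 [Ev3 Ev3']] := factor_t ij1 _ E; first len_tac.
  (* The common multiple is tau z tau z v3; [conj_btau_t] carries t_(i-2) and t_(j-2) across z tau z
     to the complements t_(i-1) and t_(j-1). *)
  exists (g z * (btau r * (g z * v3))); rewrite !compl_t //; last exact/nesym.
  by rewrite Ew1 Ew2 Ev3 Ev3' !btauE !conj_btau_t.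
(* The diagram is a path, so three letters are never pairwise adjacent. *)
- by exfalso; move: xz zy xy; rewrite /adjacent; lia.
- have xyC := fun v => distantC v xy.
  move=> /(factor_distant xy)[|v [Ev Ev']]; first len_tac.
  have [|v1 [Ew1 Ev1]] := factor_adjacent zy _ Ev; first len_tac.
  have zx : adjacent z x by rewrite adjacent_sym.
  have [|v2 [Ew2 Ev2]] := factor_adjacent zx _ Ev'; first len_tac.
  have E : g y * v1 = g x * v2.
    by apply: mulgI_lt (etrans (esym Ev1) Ev2); len_tac.
  have yx : distant y x by rewrite distant_sym.
  have [|v3 [Ev3 Ev3']] := factor_distant yx _ E; first len_tac.
  exists (g z * (g y * (g x * (g z * v3)))).
  rewrite (compl_distant xy) (compl_distant_r xy) Ew1 Ew2 Ev3 Ev3'; split.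
    by rewrite xyC xzB zyB.
  by rewrite -(xyC (g z * (g y * v3))) -zyB -xzB xyC.
Qed.

Let cube_t2 i j k : i <> j -> j <> k -> cube (tgen r i) (tgen r j) (tgen r k).
Proof.
move=> ij jk w1 w2; have [<-|/eqP ik] := eqVneq i k; first exact: cube_id.
rewrite !compl_t //; try exact/nesym.
move=> L /mulgI_lt <-; last len_tac.
by exists w1; rewrite !compl_t //; apply/nesym.
Qed.

Let cube_t_distant i j y : i <> j -> distant (tgen r j) y ->
  cube (tgen r i) (tgen r j) y.
Proof.
move=> ij jy w1 w2; have iy : distant (tgen r i) y by [].
rewrite (compl_distant jy) (compl_distant_r jy) !compl_t //; last exact/nesym.
move=> L /(factor_distant (jy : distant (tgen r (j - 1)%R) y))[|v [-> ->]].
  len_tac.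
exists (t (i - 1)%R * v); rewrite (compl_distant iy) (compl_distant_r iy).
by rewrite !btauE distantC.
Qed.

Let cube_t_adjacent i j y : i <> j -> adjacent (tgen r j) y ->
  cube (tgen r i) (tgen r j) y.
Proof.
move=> ij jy w1 w2; have ty k : adjacent (tgen r k) y by [].
have yt k : adjacent y (tgen r k) by rewrite adjacent_sym.
rewrite (compl_adjacent jy) (compl_adjacent_r jy) !compl_t //; last exact/nesym.
rewrite -!mulgA => L /(factor_adjacent (ty _))[|v1 [Ew1 Ew2]]; first len_tac.
have jj1 : j <> (j - 1)%R by lia.
have [|v2 [Ew2' Ev2]] := factor_t jj1 _ Ew2; first len_tac.
have [|v3 [Ev1 Ev2']] := factor_adjacent (yt _) _ Ev2; first len_tac.
(* Braiding the middle letters brings out two copies of tau, so the word does not depend on k. This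
   is what allows passing from j to i. *)
have bb k (v := g y * (t (k - 1 - 1)%R * v3)) :
    t k * (g y * (t (k - 1)%R * v)) = btau r * (g y * (btau r * v3)).
  by rewrite /v adjacent_braid // !btauE.
exists (t (i - 1)%R * (g y * (t (i - 1 - 1)%R * v3))).
rewrite (compl_adjacent (ty _)) (compl_adjacent_r (ty _)) -!mulgA.
rewrite Ew1 Ew2' Ev1 Ev2' !bb; split=> //.
by rewrite !btauE conj_btau_t.
Qed.

Lemma cube_condition x z y w1 w2 : blen (compl z x * w1) <= n ->
    compl z x * w1 = compl z y * w2 ->
  factor x y (compl x z * w1) (compl y z * w2).
Proof.
case: (pairP x z) => [->|i j -> -> ij|xz|xz]; first exact: cube_idl.
- case: (pairP (tgen r j) y) => [->|_ k [<-] -> jk|jy|jy].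
  + exact/cube_sym/cube_idl.
  + exact: cube_t2.
  + exact: cube_t_adjacent.
  + exact: cube_t_distant.
- case: (pairP z y) => [->|i j zi -> ij|zy|zy].
  + exact/cube_sym/cube_idl.
  + subst z; apply/cube_sym/cube_t_adjacent; first exact/nesym.
    by rewrite adjacent_sym.
  + exact: cube_adjacent2.
  + apply/cube_sym/cube_distant_adjacent; first by rewrite distant_sym.
    by rewrite adjacent_sym.
- case: (pairP z y) => [->|i j zi -> ij|zy|zy].
  + exact/cube_sym/cube_idl.
  + subst z; apply/cube_sym/cube_t_distant; first exact/nesym.
    by rewrite distant_sym.
  + exact: cube_distant_adjacent.
  + exact: cube_distant2.
Qed.

Lemma factor_trans x z y a b c : blen c <= n ->
  factor x z a c -> factor z y c b -> factor x y a b.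
Proof.
by move=> cn [w1 [-> Ec]] [w2 [Ec' ->]]; apply: cube_condition; rewrite -?Ec.
Qed.

End Cube.

(** * The complement property for the congruence, and left cancellation *)

Section Complemented.
Local Open Scope group_scope.
Variable r : nat.
Implicit Types (x y z : B_gen r) (a b c : Bplus r).

(** Each relation is the lcm relation of its two first letters, with w = 1; only the trivial case i
    = j on [tgen] letters takes another w. *)
Lemma B_rel_factor (u v : seq (B_gen r)) : B_rel u v -> exists x y u' v',
  [/\ u = x :: u', v = y :: v' & factor x y (bword u') (bword v')].
Proof.
case=> [k l kl|k l kl|i j|k i k3|k i k4]; do 4 eexists; split=> //.
- have D : distant (@sgen r k) (sgen l).
    by move: kl; rewrite /distant /s_index /=; lia.
  by exists 1; rewrite (compl_distant D) (compl_distant_r D) !mulg1.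
- have D : adjacent (@sgen r k) (sgen l).
    by move: kl; rewrite /adjacent /s_index /=; lia.
  exists 1; rewrite (compl_adjacent D) (compl_adjacent_r D) !mulg1.
  by rewrite !bword_cons !mulg1.
- have [->|/eqP ij] := eqVneq i j; first exact: factor_refl.
  by exists 1; rewrite !compl_t ?mulg1 //; apply/nesym.
- have D : adjacent (@sgen r k) (tgen r i).
    by move: k3; rewrite /adjacent /s_index /=; lia.
  exists 1; rewrite (compl_adjacent D) (compl_adjacent_r D) !mulg1.
  by rewrite !bword_cons !mulg1.
- have D : distant (@sgen r k) (tgen r i).
    by move: k4; rewrite /distant /s_index /=; lia.
  by exists 1; rewrite (compl_distant D) (compl_distant_r D) !mulg1.
Qed.

(** Strong induction on length, with an inner induction on the derivation. Only the transitivity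
    rule calls on shorter words, through the cube condition. *)
Lemma congr_factor (u v : seq (B_gen r)) : word_congr (@B_rel r) u v ->
  forall x u' y v', u = x :: u' -> v = y :: v' ->
  factor x y (bword u') (bword v').
Proof.
have [n] := ubnP (size u); elim: n u v => // n IHn u v un uv.
(* The words compared carry one more letter than a and b, hence the bound [n.-1]. *)
have factor_lt x y a b : blen a < n.-1 -> bgen x * a = bgen y * b ->
    factor x y a b.
  rewrite -(bword_repr a) -(bword_repr b) -!bword_cons blen_word => an E.
  have /word_classP {}E := E.
  by apply: IHn E _ _ _ _ erefl erefl; rewrite /= -ltn_predRL.
elim: uv un => {u v}.
- move=> u v R _ x u' y v' xu yv; have [x0 [y0 [u0 [v0]]]] := B_rel_factor R.
  by rewrite xu yv => -[[-> ->] [-> ->]].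
- by move=> _ _ x u' y v' -> [-> ->]; apply: factor_refl.
- move=> u v uv IH vn x u' y v' xu yv; apply/factor_sym/IH => //.
  by rewrite (B_congr_size uv).
- move=> u v w uv IHuv vw IHvw un x u' y v' xu yv.
  have uv_size := B_congr_size uv.
  (* Congruent words have equal length, so v is nonempty; its first letter z links x to y. *)
  case Ev: v => [|z w']; first by move: uv_size; rewrite xu Ev.
  apply: (factor_trans factor_lt (z := z) (c := bword w')).
  + by rewrite blen_word; move: un; rewrite uv_size Ev /=; lia.
  + exact: IHuv.
  + by apply: IHvw; rewrite -?uv_size.
- move=> u u' v v' uu' IHu vv' IHv; rewrite size_cat => un x p y q.
  have := B_congr_size uu'; case: u u' uu' IHu un => [|x0 u] [|y0 u'] //=.
    by move=> _ _ un _; apply: IHv.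
  move=> uu' IHu un _ [<- <-] [<- <-]; rewrite !bword_cat.
  have <- : bword v = bword v' by apply/word_classP.
  by apply/factorMr/IHu => //; apply: leq_ltn_trans un; apply: leq_addr.
Qed.

Theorem gen_mul_factor x y a b : bgen x * a = bgen y * b -> factor x y a b.
Proof.
rewrite -(bword_repr a) -(bword_repr b) -!bword_cons => /word_classP E.
exact: congr_factor E _ _ _ _ _ _.
Qed.

Lemma bplus_mulgI a b c : a * b = a * c -> b = c.
Proof.
elim/bplus_ind: a => [|x a IHa]; first by rewrite !mul1g.
rewrite -!mulgA => /gen_mul_factor[w []]; rewrite compl_id mul1g => E E'.
by apply: IHa; rewrite E E'.
Qed.

End Complemented.

(** * Generalities on left divisibility *)

Section Divisibility.
Local Open Scope group_scope.
Variable M : monoidType.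
Implicit Types a b c m : M.

Lemma left_divides_refl a : left_divides a a.
Proof. by exists 1; rewrite mulg1. Qed.

Lemma left_divides_trans a b c :
  left_divides a b -> left_divides b c -> left_divides a c.
Proof. by move=> [p ->] [q ->]; exists (p * q); rewrite mulgA. Qed.

Lemma left_divides1 a : left_divides 1 a.
Proof. by exists a; rewrite mul1g. Qed.

Lemma left_divides_mulr a b : left_divides a (a * b).
Proof. by exists b. Qed.

Lemma left_divides_mul2l c a b : left_divides a b -> left_divides (c * a) (c * b).
Proof. by move=> [p ->]; exists p; rewrite mulgA. Qed.

End Divisibility.
Arguments left_divides_refl {M a}.
Arguments left_divides1 {M a}.
Arguments left_divides_mulr {M a b}.

(** * Joins and meets for left divisibility *)

Section Lattice.
Local Open Scope group_scope.
Variable r : nat.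
Implicit Types (x y z : B_gen r) (a b c d m : Bplus r).

Lemma left_divides_mulI c a b : left_divides (c * a) (c * b) -> left_divides a b.
Proof. by move=> [p]; rewrite -mulgA => /bplus_mulgI ->; exists p. Qed.

(* For [a = x a'] and [b = y b'], with [x] and [y] generators, the lcm of [a]
   and [b] is computed from lcm(a', x\y) and lcm(b', y\x), both of which divide
   a proper right factor of [m]. *)
Lemma join_below m a b : left_divides a m -> left_divides b m ->
  exists2 j, is_join (@left_divides (Bplus r)) a b j & left_divides j m.
Proof.
have [n] := ubnP (blen m); elim: n m a b => // n IHn m a b mn am bm.
have [->|[x [a' aE]]] := bplus_case a.
  by exists b => //; split=> //; [apply: left_divides1 | apply: left_divides_refl].
have [->|[y [b' bE]]] := bplus_case b.
  by exists a => //; split=> //; [apply: left_divides_refl | apply: left_divides1].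
(* An arbitrary common multiple c is allowed, since this serves both for m and for the minimality of
   the join. *)
have lcm_factor c : left_divides a c -> left_divides b c -> exists w,
    [/\ c = bgen x * (compl x y * w), left_divides a' (compl x y * w)
      & left_divides b' (compl y x * w)].
  move=> [p cE] [q cE']; have E : bgen x * (a' * p) = bgen y * (b' * q).
    by rewrite !mulgA -aE -bE -cE.
  have [w [E1 E2]] := gen_mul_factor E; exists w; split.
  - by rewrite cE aE -mulgA E1.
  - by rewrite -E1; apply: left_divides_mulr.
  - by rewrite -E2; apply: left_divides_mulr.
have [w [mE a'w b'w]] := lcm_factor m am bm.
have mE' : m = bgen y * (compl y x * w) by rewrite mE compl_lcm.
have wn : blen (compl x y * w) < n by move: mn; rewrite mE !blenE; lia.
have wn' : blen (compl y x * w) < n by move: mn; rewrite mE' !blenE; lia.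
have [j1 [a'j1 [p1 j1E] j1_min] j1w] := IHn _ _ _ wn a'w left_divides_mulr.
have [j2 [b'j2 [p2 j2E] j2_min] j2w] := IHn _ _ _ wn' b'w left_divides_mulr.
subst j1 j2; have wn'' : blen w < n by move: wn; rewrite !blenE; lia.
(* The partial joins are (x\y) p1 and (y\x) p2; what remains is the join of p1 and p2, both of which
   divide w. *)
have [j3 [p1j3 p2j3 j3_min] j3w] := IHn _ _ _ wn''
  (left_divides_mulI j1w) (left_divides_mulI j2w).
exists (bgen x * (compl x y * j3)); last first.
  by rewrite mE; do 2 apply: left_divides_mul2l.
split.
- rewrite aE; apply: left_divides_mul2l; apply: left_divides_trans a'j1 _.
  exact: left_divides_mul2l.
- rewrite compl_lcm bE; apply: left_divides_mul2l; apply: left_divides_trans b'j2 _.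
  exact: left_divides_mul2l.
- move=> z az bz; have [v [-> a'v b'v]] := lcm_factor z az bz.
  do 2 apply: left_divides_mul2l; apply: j3_min.
    by apply/left_divides_mulI/j1_min => //; apply: left_divides_mulr.
  by apply/left_divides_mulI/j2_min => //; apply: left_divides_mulr.
Qed.

Lemma left_divides_blen a b : left_divides a b -> blen a <= blen b.
Proof. by case=> c ->; rewrite blenM leq_addr. Qed.

Lemma left_divides_blen_eq a b :
  left_divides a b -> blen b <= blen a -> a = b.
Proof.
case=> c ->; rewrite blenM => cle; have /blen_eq0 -> : blen c = 0 by lia.
by rewrite mulg1.
Qed.

(* A common divisor of maximal length absorbs every other one, since the join
   of two common divisors is again a common divisor. *)
Lemma meet_exists a b : exists m, is_meet (@left_divides (Bplus r)) a b m.
Proof.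
pose common d := left_divides d a /\ left_divides d b.
(* Induction on the gap in length between a and the current common divisor, which starts at 1. *)
have [n] := ubnP (blen a - blen (1 : Bplus r)).
have : common 1 by split; apply: left_divides1.
elim: n (1 : Bplus r) => // n IHn d [da db] dn.
have [[z [za zb Nzd]]|max_d] := EM (exists e,
    [/\ left_divides e a, left_divides e b & ~ left_divides e d]); last first.
  exists d; split=> // z za zb; apply: contrapT => Nzd.
  by apply: max_d; exists z.
have [j [dj zj j_min] ja] := join_below da za.
apply: (IHn j); first by split=> //; apply: j_min.
have := left_divides_blen ja; have := left_divides_blen dj.
have : blen d <> blen j.
  move=> dj_eq; apply: Nzd; rewrite (left_divides_blen_eq dj) //.
  by rewrite dj_eq.
lia.
Qed.

Lemma left_lattice :
    (forall a b, exists m, left_divides a m /\ left_divides b m) ->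
  lattice_order (@left_divides (Bplus r)).
Proof.
move=> common; split.
- by move=> a; apply: left_divides_refl.
- by move=> a b ab /left_divides_blen; apply: left_divides_blen_eq.
- exact: left_divides_trans.
- exact: meet_exists.
- by move=> a b; have [m [/join_below J /J[j ? _]]] := common a b; exists j.
Qed.

End Lattice.

(** * The reversing anti-automorphism and right divisibility *)

Section Antiautomorphism.
Local Open Scope group_scope.
Variable r : nat.
Implicit Types (x y z : B_gen r) (a b c d m : Bplus r) (u v : seq (B_gen r)).

(** Reversal turns t_i t_(i-1) into t_(i-1) t_i; negating indices makes it t_(1-i) t_(-i), again an
    expression of tau. *)
Definition star_gen x : B_gen r :=
  match x with inl i => inl (- i)%R | inr k => inr k end.

Definition star_word u := rev (map star_gen u).

Lemma star_genK : involutive star_gen.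
Proof. by case=> // i; rewrite /= GRing.opprK. Qed.

Lemma star_wordK : involutive star_word.
Proof.
by move=> u; rewrite /star_word map_rev revK -map_comp map_id_in // => x _;
  apply: star_genK.
Qed.

Lemma star_word_cat u v : star_word (u ++ v) = star_word v ++ star_word u.
Proof. by rewrite /star_word map_cat rev_cat. Qed.

Lemma star_word_congr u v : word_congr (@B_rel r) u v ->
  word_congr (@B_rel r) (star_word u) (star_word v).
Proof.
elim=> {u v}; last first.
- move=> u u' v v' _ uu' _ vv'; rewrite !star_word_cat; exact: congr_cat.
- by move=> u v w _ uv _; apply: congr_trans uv.
- by move=> u v _; apply: congr_sym.
- by move=> u; apply: congr_refl.
move=> u v [k l kl|k l kl|i j|k i k3|k i k4]; rewrite /star_word /=.
- by apply: congr_rel; apply: rel_ss_comm; rewrite orbC.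
- by apply: congr_rel; apply: rel_ss_braid.
- rewrite !GRing.opprB /rev /=; apply: congr_rel.
  have E (k : int) : (1 - k - 1 = - k)%R by lia.
  by have := rel_tt r (1 - i)%R (1 - j)%R; rewrite !E.
- by apply: congr_rel; apply: rel_s3t.
- by apply/congr_sym/congr_rel; apply: rel_st.
Qed.

Definition star a : Bplus r := bword (star_word (repr a)).

Lemma starE u : star (bword u) = bword (star_word u).
Proof. exact/word_classP/star_word_congr/congr_repr. Qed.

Lemma starM a b : star (a * b) = star b * star a.
Proof.
rewrite -(bword_repr a) -(bword_repr b) -bword_cat !starE.
by rewrite star_word_cat bword_cat.
Qed.

Lemma starK : involutive star.
Proof. by move=> a; rewrite -(bword_repr a) !starE star_wordK. Qed.

Lemma star_left_divides a b :
  left_divides a b <-> right_divides (star a) (star b).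
Proof.
split=> -[c].
  by move->; exists (star c); rewrite starM.
by rewrite -{2}(starK b) => ->; exists (star c); rewrite starM starK.
Qed.

Lemma star_right_divides a b :
  right_divides a b <-> left_divides (star a) (star b).
Proof. by have := star_left_divides (star a) (star b); rewrite !starK => -[]. Qed.

Lemma bplus_cancellative : cancellative (Bplus r).
Proof.
split; first exact: bplus_mulgI.
move=> a b c /(congr1 star); rewrite !starM => /bplus_mulgI.
exact: (can_inj starK).
Qed.

Lemma right_lattice :
    lattice_order (@left_divides (Bplus r)) ->
  lattice_order (@right_divides (Bplus r)).
Proof.
case=> refl antisym trans meet join.
split.
- by move=> a; apply/star_right_divides.
- move=> a b /star_right_divides ab /star_right_divides ba.
  by apply: (can_inj starK); apply: antisym.
- move=> a b c /star_right_divides ab /star_right_divides bc.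
  by apply/star_right_divides; apply: trans ab bc.
- move=> a b; have [m [ma mb m_max]] := meet (star a) (star b).
  exists (star m); split; try by apply/star_right_divides; rewrite starK.
  move=> z /star_right_divides za /star_right_divides zb.
  by apply/star_right_divides; rewrite starK; apply: m_max.
- move=> a b; have [m [ma mb m_max]] := join (star a) (star b).
  exists (star m); split; try by apply/star_right_divides; rewrite starK.
  move=> z /star_right_divides za /star_right_divides zb.
  by apply/star_right_divides; rewrite starK; apply: m_max.
Qed.

End Antiautomorphism.

(** * Jucys-Murphy elements and the factorisation of [Lambda] *)

Section JucysMurphy.
Local Open Scope group_scope.

Lemma commuteCA (G : semigroupType) (a b : G) :
  commute a b -> forall c, a * (b * c) = b * (a * c).
Proof. by move=> ab c; rewrite !mulgA ab. Qed.

Variable r : nat.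
Local Notation n := (r - 2).
Local Notation t i := (bgen (tgen r i)).
Local Notation tau := (btau r).
Implicit Types (x y z : B_gen r) (a b c : Bplus r) (j k l m : nat).

(* [bs k] is s_(k+3), extended by the junk value 1 for [n <= k]. *)
Definition bs k : Bplus r := if insub k is Some o then bgen (sgen o) else 1.

Lemma bs_ord (o : 'I_n) : bs o = bgen (sgen o).
Proof. by rewrite /bs valK. Qed.

Lemma bsE k : k < n -> exists2 o : 'I_n, o = k :> nat & bs k = bgen (sgen o).
Proof. by move=> kn; exists (Ordinal kn) => //; rewrite -bs_ord. Qed.

Lemma commuteE x y : distant x y -> commute (bgen x) (bgen y).
Proof. by move=> /(distantC 1); rewrite !mulg1. Qed.

Lemma bs_commute k l : k.+1 < l -> l < n -> commute (bs k) (bs l).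
Proof.
move=> kl ln; have [o oE ->] := bsE ln; have [|p pE ->] := @bsE k; first lia.
by apply: commuteE; rewrite /distant /= oE pE; lia.
Qed.

Lemma bs_braid k : k.+1 < n -> bs k * bs k.+1 * bs k = bs k.+1 * bs k * bs k.+1.
Proof.
move=> kn; have [o oE ->] := bsE kn; have [|p pE ->] := @bsE k; first lia.
have A : adjacent (sgen p) (sgen o) by rewrite /adjacent /= oE pE; lia.
by have := adjacent_braid 1 A; rewrite !mulg1 !mulgA.
Qed.

Lemma bs_braidA k c : k.+1 < n ->
  bs k * (bs k.+1 * (bs k * c)) = bs k.+1 * (bs k * (bs k.+1 * c)).
Proof. by move=> kn; rewrite !mulgA bs_braid. Qed.

Lemma bs_t k i : 0 < k -> k < n -> commute (bs k) (t i).
Proof.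
move=> k0 kn; have [o oE ->] := bsE kn.
by apply: commuteE; rewrite /distant /= oE; lia.
Qed.

Lemma bs_tau k : 0 < k -> k < n -> commute (bs k) tau.
Proof. by move=> *; apply: commuteM; apply: bs_t. Qed.

Lemma tauE i : t i * t (i - 1)%R = tau.
Proof. by have := @btauE r i 1; rewrite !mulg1. Qed.

Lemma t_tau i : t i * tau = tau * t (i - 2)%R.
Proof.
rewrite -{1}(tauE (i - 1)%R) mulgA tauE; congr (_ * t _); lia.
Qed.

(* Jucys-Murphy elements of the Artin group of type B generated by [tau] and
   the [bs k]; their product is its Garside element. *)
Fixpoint jm k : Bplus r := if k is k'.+1 then bs k' * (jm k' * bs k') else tau.

Fixpoint jm_prod k : Bplus r := if k is k'.+1 then jm k * jm_prod k' else tau.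

(** For k = r - 2 this is the base of the power defining [Lambda]. *)
Fixpoint coxeter k : Bplus r := if k is k'.+1 then bs k' * coxeter k' else tau.

Lemma jmS k : jm k.+1 = bs k * (jm k * bs k).
Proof. by []. Qed.

Lemma jm_prodS k : jm_prod k.+1 = jm k.+1 * jm_prod k.
Proof. by []. Qed.

Lemma coxeterS k : coxeter k.+1 = bs k * coxeter k.
Proof. by []. Qed.

(** The innermost layer is [conj_btau_t] for s_3; the outer letters commute with every t_i. *)
Lemma t_jm i k : k < n -> t i * jm k.+1 = jm k.+1 * t (i - 1)%R.
Proof.
elim: k => [|k IHk] kn.
  have [o oE oE'] := bsE kn; rewrite /= oE'.
  have A : adjacent (sgen o) (tgen r i) by rewrite /adjacent /= oE.
  by have := conj_btau_t 1 A; rewrite !mulg1 -!mulgA => ->.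
have C (l : int) := @bs_t k.+1 l isT kn.
rewrite jmS -(commuteCA (C i)).
by rewrite (mulgA (t i)) IHk 1?ltnW // -!mulgA (C (i - 1)%R).
Qed.

Lemma bs_jm_above j k : k < j -> j < n -> commute (bs j) (jm k).
Proof.
elim: k => [|k IHk] kj jn; first exact: bs_tau.
have C : commute (bs j) (bs k) by apply/commute_sym/bs_commute.
by apply: commuteM => //; apply: commuteM => //; apply: IHk => //; apply: ltnW.
Qed.

(** In [jm j.+2] a braid on the left turns [bs j] into [bs j.+1], which commutes with [jm j]; a
    braid on the right turns it back. Further layers commute with [bs j]. *)
Lemma bs_jm_below j k : j.+1 < k -> k <= n -> commute (bs j) (jm k).
Proof.
elim: k => // k IHk; rewrite ltnS leq_eqVlt => /orP[/eqP <-|jk] kn.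
  have C : commute (bs j.+1) (jm j) by apply: bs_jm_above.
  rewrite /commute !jmS -!mulgA bs_braidA // (commuteCA C).
  by have := bs_braidA 1 kn; rewrite !mulg1 => ->.
have C : commute (bs j) (bs k) by apply: bs_commute.
by apply: commuteM => //; apply: commuteM => //; apply: IHk => //; apply: ltnW.
Qed.

(** Both letters of tau = t_1 t_0 are shifted by one, and t_0 t_(-1) is tau again. *)
Lemma tau_jm k : k <= n -> commute tau (jm k).
Proof.
case: k => // k kn; rewrite -(tauE 1%R) /commute -mulgA t_jm // mulgA t_jm //.
by rewrite -mulgA; congr (_ * _); rewrite !tauE.
Qed.

Lemma jm_commute k l : k < l -> l <= n -> commute (jm k) (jm l).
Proof.
elim: k => [|k IHk] kl ln; first exact: tau_jm.
apply/commute_sym; have C : commute (jm l) (bs k).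
  by apply/commute_sym/bs_jm_below.
apply: commuteM => //; apply: commuteM => //; apply/commute_sym/IHk => //.
exact: ltnW.
Qed.

Lemma t_jm_prod i k :
  k <= n -> t i * jm_prod k = jm_prod k * t (i - 2 - k%:Z)%R.
Proof.
elim: k i => [|k IHk] i kn; first by rewrite GRing.subr0 t_tau.
rewrite jm_prodS mulgA t_jm // -!mulgA IHk; last exact: ltnW.
by have -> : (i - 1 - 2 - k%:Z = i - 2 - k.+1%:Z)%R by lia.
Qed.

Lemma bs_jm_prod_above j k : k < j -> j < n -> commute (bs j) (jm_prod k).
Proof.
elim: k => [|k IHk] kj jn; first exact: bs_tau.
by apply: commuteM; [apply: bs_jm_above | apply: IHk => //; apply: ltnW].
Qed.

(** With s = [bs k] and a = [jm k], commutation of s a s with a reads s a s a = a s a s, so s (a s a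
    s) = (s a s a) s. *)
Lemma bs_jm_pair k : k < n -> commute (bs k) (jm k.+1 * jm k).
Proof.
move=> kn; have := jm_commute (ltnSn k) kn; rewrite /commute => C.
by rewrite -{1}C jmS -!mulgA.
Qed.

(** Only the factors [jm j.+1] and [jm j] fail to commute with [bs j] one by one; they are adjacent
    in the product and are treated as a pair. *)
Lemma bs_jm_prod j k : j < k -> k <= n -> commute (bs j) (jm_prod k).
Proof.
elim: k => // k IHk; rewrite ltnS leq_eqVlt => /orP[/eqP -> |jk] kn.
  case: k {IHk} kn => [|k] kn; first exact: (bs_jm_pair kn).
  rewrite !jm_prodS mulgA.
  by apply: commuteM; [apply: bs_jm_pair | apply: bs_jm_prod_above].
apply: commuteM; first by apply: bs_jm_below.
by apply: IHk => //; apply: ltnW.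
Qed.

Lemma tau_divides_jm_prod k : k <= n -> left_divides tau (jm_prod k).
Proof.
elim: k => [|k IHk] kn; first exact: left_divides_refl.
have [c cE] := IHk (ltnW kn); exists (jm k.+1 * c).
by rewrite (commuteCA (tau_jm kn)) -cE.
Qed.

Lemma bs_divides_jm_prod j k :
  j < k -> k <= n -> left_divides (bs j) (jm_prod k).
Proof.
elim: k => // k IHk; rewrite ltnS leq_eqVlt => /orP[/eqP -> |jk] kn.
  by rewrite jm_prodS jmS -!mulgA; apply: left_divides_mulr.
have [c cE] := IHk jk (ltnW kn); exists (jm k.+1 * c).
by rewrite (commuteCA (bs_jm_below _ kn)) // -cE.
Qed.

Fixpoint bs_range j m : Bplus r :=
  if m is m'.+1 then bs_range j m' * bs (j + m') else 1.

Lemma bs_rangeS j m : bs_range j m.+1 = bs_range j m * bs (j + m).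
Proof. by []. Qed.

Lemma bs_coxeter_above j k : k < j -> j < n -> commute (bs j) (coxeter k).
Proof.
elim: k => [|k IHk] kj jn; first exact: bs_tau.
by apply: commuteM; [apply/commute_sym/bs_commute | apply: IHk => //; apply: ltnW].
Qed.

(** The outer letters commute with [bs j], the letters [bs j.+1] and [bs j] braid with it, and the
    inner part commutes with the resulting [bs j.+1]. *)
Lemma bs_coxeter j k : j.+1 < k -> k <= n ->
  bs j * coxeter k = coxeter k * bs j.+1.
Proof.
elim: k => // k IHk; rewrite ltnS leq_eqVlt => /orP[/eqP <-|jk] kn.
  by rewrite !coxeterS bs_braidA // -!mulgA -bs_coxeter_above.
rewrite coxeterS (commuteCA (bs_commute jk kn)) IHk //; last exact: ltnW.
by rewrite mulgA.
Qed.

Lemma coxeter_bs_range j m k : j + m < k -> k <= n ->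
  coxeter k * bs_range j.+1 m = bs_range j m * coxeter k.
Proof.
elim: m => [|m IHm] jmk kn; first by rewrite mulg1 mul1g.
rewrite !bs_rangeS mulgA IHm //; last by lia.
by rewrite -!mulgA addSn bs_coxeter //; lia.
Qed.

(** Each new factor [coxeter k.+1] lowers the collected run by one index as it passes, then releases
    its leading [bs k] at the end of the run. *)
Lemma coxeterX k m : m <= k.+1 -> k < n ->
  coxeter k.+1 ^+ m = bs_range (k.+1 - m) m * coxeter k ^+ m.
Proof.
elim: m => [|m IHm] mk kn; first by rewrite mul1g.
rewrite expgS IHm ?(ltnW mk) // mulgA.
have -> : k.+1 - m = (k.+1 - m.+1).+1 by lia.
rewrite coxeter_bs_range //; last by lia.
rewrite bs_rangeS expgS coxeterS -!mulgA.
by have -> : k.+1 - m.+1 + m = k by lia.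
Qed.

Lemma jm_coxeter k : jm k = coxeter k * bs_range 0 k.
Proof. by elim: k => [|k IHk]; [rewrite mulg1 | rewrite /= IHk -!mulgA]. Qed.

(** Set one Coxeter factor aside: by [coxeterX] the others release exactly the run that completes it
    to the top Jucys-Murphy element. *)
Lemma jm_prod_coxeter k : k <= n -> jm_prod k = coxeter k ^+ k.+1.
Proof.
elim: k => [|k IHk] kn; first by rewrite expg1.
rewrite expgS coxeterX // subnn jm_prodS IHk; last exact: ltnW.
by rewrite jm_coxeter -mulgA.
Qed.

Lemma coxeter_prod k : (\prod_(i < k) bs (k - i.+1)) * tau = coxeter k.
Proof.
elim: k => [|k IHk]; first by rewrite big_ord0 mul1g.
by rewrite big_ord_recl subn1 /= -mulgA IHk.
Qed.

Lemma LambdaE : 2 <= r -> Lambda r = jm_prod n.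
Proof.
move=> r2; rewrite jm_prod_coxeter // -coxeter_prod /Lambda.
have <- : r - 1 = (r - 2).+1 by lia.
rewrite -mulgA; congr ((_ * _) ^+ _).
by apply: eq_bigr => k _; rewrite -[RHS]/(bs (rev_ord k)) bs_ord.
Qed.

Lemma t_Lambda i : 2 <= r -> t i * Lambda r = Lambda r * t (i - r%:Z)%R.
Proof.
move=> r2; rewrite LambdaE // t_jm_prod //.
by congr (_ * t _); lia.
Qed.

Lemma s_Lambda (o : 'I_n) : 2 <= r -> commute (bgen (sgen o)) (Lambda r).
Proof. by move=> r2; rewrite LambdaE // -bs_ord; apply: bs_jm_prod. Qed.

Lemma gen_divides_Lambda x : 2 <= r -> left_divides (bgen x) (Lambda r).
Proof.
move=> r2; rewrite LambdaE //; case: x => [i|o]; last first.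
  by rewrite -[inr o]/(sgen o) -bs_ord; apply: bs_divides_jm_prod.
apply: left_divides_trans (tau_divides_jm_prod _) => //.
by rewrite -(tauE i); apply: left_divides_mulr.
Qed.

End JucysMurphy.

(** * Quasi-central elements *)

Section QuasiCentral.
Local Open Scope group_scope.
Variables (M : monoidType) (D : M).
Implicit Types a b c : M.
Hypothesis Mcancel : cancellative M.
Hypothesis D_right : forall a, exists b, a * D = D * b.
Hypothesis D_left : forall a, exists b, D * a = b * D.

(** If D = a b, then D b = b' D = b' a b for some b', and cancelling b gives D = b' a; the converse
    is symmetric. *)
Lemma quasi_central_balanced a : left_divides a D <-> right_divides a D.
Proof.
have [mulI mulIr] := Mcancel; split=> -[b DE].
  have [b' E] := D_left b; exists b'.
  by apply: (mulIr b); rewrite E {1}DE mulgA.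
have [b' E] := D_right b; exists b'.
by apply: (mulI b); rewrite E {1}DE mulgA.
Qed.

Lemma quasi_centralX_right m a : exists b, a * D ^+ m = D ^+ m * b.
Proof.
elim: m a => [|m IHm] a; first by exists a; rewrite mulg1 mul1g.
have [b ab] := D_right a; have [c bc] := IHm b; exists c.
by rewrite expgS mulgA ab -mulgA bc mulgA.
Qed.

End QuasiCentral.

(** * Embedding into the group of fractions *)

Section Fractions.
Local Open Scope group_scope.
Variables (X : choiceType) (R : seq X -> seq X -> Prop).
Local Notation M := (presented_monoid R).
Local Notation G := (presented_group R).
Local Notation f := (@monoid_to_group X R).
Implicit Types (x : X) (a b c : M) (u v : seq X) (w : seq (X * bool)) (g : G).

Lemma monoid_to_group1 : f 1 = 1.
Proof. exact: monoid_to_groupE. Qed.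

Lemma monoid_to_groupM a b : f (a * b) = f a * f b.
Proof.
rewrite -(word_class_repr a) -(word_class_repr b) [_ * _]pm_mulE.
by rewrite !monoid_to_groupE /positive_word map_cat [RHS]pm_mulE.
Qed.

Lemma word_class_cons x u :
  word_class R (x :: u) = monoid_gen R x * word_class R u.
Proof. by rewrite [RHS]pm_mulE. Qed.

Lemma group_word_cons x e w :
  word_class (group_rel R) ((x, e) :: w) =
  (if e then (f (monoid_gen R x))^-1 else f (monoid_gen R x))
  * word_class (group_rel R) w.
Proof.
rewrite -[LHS](pm_mulE _ [:: (x, e)]) monoid_to_groupE; congr (_ * _).
case: e => //; apply/esym/(@mulg1_eq G); rewrite [LHS]pm_mulE.
exact/word_classP/congr_rel/(group_rel_inv R x false).
Qed.

Lemma left_fraction g :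
    (forall a b, exists c d, a * c = b * d) ->
  exists a b, g = f a * (f b)^-1.
Proof.
move=> ore; rewrite -(word_class_repr g); elim: (repr g) => [|[x e] w [a [b IH]]].
  by exists 1, 1; rewrite monoid_to_group1 mulgV.
rewrite group_word_cons IH; case: e.
  (* From x c = a d one gets x^-1 a = c d^-1 in the group. *)
  have [c [d E]] := ore (monoid_gen R x) a; exists c, (b * d).
  have := congr1 f E; rewrite !monoid_to_groupM => {}E.
  rewrite invgM !mulgA; congr (_ * _).
  by rewrite -[LHS](mulgK (f d)) -(mulgA _ (f a)) -E mulKg.
by exists (monoid_gen R x * a), b; rewrite monoid_to_groupM mulgA.
Qed.

Lemma right_fraction g :
    (forall a b, exists c d, c * a = d * b) ->
  exists a b, g = (f a)^-1 * f b.
Proof.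
(* Reading a word for g^-1 lets letters join g on its right, next to the numerator f b. *)
move=> ore; rewrite -[g]invgK -(word_class_repr g^-1).
elim: (repr g^-1) => [|[x e] w [a [b IH]]].
  by exists 1, 1; rewrite monoid_to_group1 mulVg; exact: invg1.
rewrite group_word_cons invgM IH; case: e.
  exists a, (b * monoid_gen R x); by rewrite invgK monoid_to_groupM mulgA.
have [c [d E]] := ore b (monoid_gen R x); exists (c * a), d.
have := congr1 f E; rewrite !monoid_to_groupM => {}E.
rewrite invgM -!mulgA; congr (_ * _).
by rewrite -[LHS](mulKg (f c)) (mulgA (f c)) E mulgK.
Qed.

(* The pair [(n, a)] stands for the fraction [D^-n a]; signed words act on the
   right of such fractions. *)
Lemma monoid_to_group_inj (D : M) : cancellative M ->
    (forall a, exists b, D * a = b * D) ->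
    (forall x, right_divides (monoid_gen R x) D) ->
  injective f.
Proof.
move=> [mulI mulIr] /choice[phi phiE] /choice[co coE].
(* Since D = [co x] x and a D^-1 = D^-1 [phi a], one has D^-n a x^-1 = D^-(n+1) [phi a] [co x]. *)
pose act (p : nat * M) (l : X * bool) : nat * M :=
  if l.2 then (p.1.+1, phi p.2 * co l.1) else (p.1, p.2 * monoid_gen R l.1).
(* Equality of fractions with denominators cleared; powers of D commute with each other. *)
pose eqf (p q : nat * M) := D ^+ q.1 * p.2 = D ^+ p.1 * q.2.
have eqf_trans q p s : eqf p q -> eqf q s -> eqf p s.
  move: p q s => [n a] [m b] [k c]; rewrite /eqf /= => ab bc.
  apply: (mulI (D ^+ m)).
  rewrite mulgA -expgnDr addnC expgnDr -mulgA ab mulgA -expgnDr addnC.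
  by rewrite expgnDr -mulgA bc !mulgA -!expgnDr addnC.
have eqf_act p q l : eqf p q -> eqf (act p l) (act q l).
  move: p q l => [n a] [m b] [x []]; rewrite /eqf /act /= => ab.
    have D2 k c : D ^+ k.+1 * (D * c) = D * D * (D ^+ k * c).
      by rewrite mulgA -expgSr !expgS -!mulgA.
    apply: (mulIr (monoid_gen R x)).
    by rewrite -!mulgA -!coE -!phiE !D2 ab.
  by rewrite !mulgA ab.
have eqf_acts p q w : eqf p q -> eqf (foldl act p w) (foldl act q w).
  by elim: w p q => // l w IHw p q pq; apply/IHw/eqf_act.
have act_positive n a u :
    foldl act (n, a) (positive_word u) = (n, a * word_class R u).
  elim: u a => [|x u IHu] a; first by rewrite /= mulg1.
  by rewrite [LHS]IHu word_class_cons mulgA.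
have act_congr w w' : word_congr (group_rel R) w w' ->
    forall p q, eqf p q -> eqf (foldl act p w) (foldl act q w').
  elim=> {w w'}.
  - move=> _ _ [u v uv|x e] p q pq.
      move: p q pq => [n a] [m b]; rewrite !act_positive /eqf /= => ab.
      have -> : word_class R u = word_class R v by apply/word_classP/congr_rel.
      by rewrite !mulgA ab.
    (* Both x x^-1 and x^-1 x send (n, a) to (n + 1, D a), the same fraction; for x x^-1 this is
       checked after multiplying by x on the right. *)
    apply: (eqf_trans p) => //; case: p pq => [n a] _.
    rewrite /eqf; case: e; rewrite /act /= expgSr -!mulgA.
      by rewrite -coE -phiE.
    congr (_ * _); apply: (mulIr (monoid_gen R x)).
    by rewrite -!mulgA -coE -phiE.
  - by move=> w p q; apply: eqf_acts.
  - by move=> u v _ IH p q /esym pq; apply/esym/IH.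
  - move=> u v w _ IHuv _ IHvw p q pq; apply: (eqf_trans (foldl act p v)).
      exact: IHuv.
    exact: IHvw.
  - by move=> u u' v v' _ IHu _ IHv p q pq; rewrite !foldl_cat; apply/IHv/IHu.
(* Acting on (0, 1), a positive word returns its own class in the monoid. *)
move=> a b; rewrite -(word_class_repr a) -(word_class_repr b) !monoid_to_groupE.
move=> /word_classP /act_congr /(_ (0, 1) (0, 1) erefl).
by rewrite !act_positive /eqf /= !mul1g.
Qed.

End Fractions.

(** * The quasi-Garside structure given by [Lambda] *)

Section QuasiGarside.
Local Open Scope group_scope.
Variable r : nat.
Hypothesis r2 : 2 <= r.
Implicit Types (x : B_gen r) (a b c m : Bplus r).

Lemma Lambda_right a : exists b, a * Lambda r = Lambda r * b.
Proof.
elim/bplus_ind: a => [|x a [b ab]]; first by exists 1; rewrite mulg1 mul1g.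
have [y xy] : exists y, bgen x * Lambda r = Lambda r * bgen y.
  case: x => [i|o]; first by exists (tgen r (i - r%:Z)%R); apply: t_Lambda.
  by exists (sgen o); apply: s_Lambda.
by exists (bgen y * b); rewrite -mulgA ab !mulgA xy.
Qed.

Lemma Lambda_left a : exists b, Lambda r * a = b * Lambda r.
Proof.
elim/bplus_ind: a => [|x a [b ab]]; first by exists 1; rewrite mulg1 mul1g.
have [y xy] : exists y, Lambda r * bgen x = bgen y * Lambda r.
  case: x => [i|o]; last by exists (sgen o); apply/esym/s_Lambda.
  exists (tgen r (i + r%:Z)%R); rewrite t_Lambda //.
  by rewrite GRing.addrK.
by exists (bgen y * b); rewrite mulgA xy -!mulgA ab.
Qed.

Lemma Lambda_garside : garside_element (Lambda r).
Proof.
split.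
  apply: quasi_central_balanced.
  - exact: bplus_cancellative.
  - exact: Lambda_right.
  - exact: Lambda_left.
elim/bplus_ind=> [|x _ [s [sD ->]]]; first by exists [::]; rewrite big_nil.
exists (bgen x :: s); rewrite big_cons; split=> // y.
by rewrite inE => /orP[/eqP ->|/sD //]; apply: gen_divides_Lambda.
Qed.

(** Write Lambda = x c; c passes through the power of [Lambda] that a divides, so x times that power
    divides the next power. *)
Lemma divides_LambdaX a : left_divides a (Lambda r ^+ blen a).
Proof.
elim/bplus_ind: a => [|x a [b ab]]; first exact: left_divides1.
have [c xc] := gen_divides_Lambda x r2.
have [d cd] := quasi_centralX_right Lambda_right (blen a) c.
exists (b * d); rewrite !blenE add1n expgS {1}xc -!mulgA cd.
by rewrite {1}ab -!mulgA.
Qed.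

Lemma common_right_multiple a b : exists c d, a * c = b * d.
Proof.
have [c ac] := divides_LambdaX a; have [d bd] := divides_LambdaX b.
exists (c * Lambda r ^+ blen b), (d * Lambda r ^+ blen a).
by rewrite !mulgA -ac -bd -!expgnDr addnC.
Qed.

Lemma common_left_multiple a b : exists c d, c * a = d * b.
Proof.
have [c [d E]] := common_right_multiple (star a) (star b).
exists (star c), (star d); have := congr1 (@star r) E.
by rewrite !starM !starK.
Qed.

Lemma bplus_left_lattice : lattice_order (@left_divides (Bplus r)).
Proof.
apply: left_lattice => a b; have [c [d E]] := common_right_multiple a b.
by exists (a * c); split; [exists c | exists d].
Qed.

Lemma bplus_quasi_garside : quasi_garside_monoid (Bplus r).
Proof.
split.
- exact: bplus_atomic.
- exact: bplus_cancellative.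
- exact: bplus_left_lattice.
- exact/right_lattice/bplus_left_lattice.
- by exists (Lambda r); apply: Lambda_garside.
Qed.

Lemma bplus_group_of_fractions : is_group_of_fractions (@Bplus_to_B r).
Proof.
split.
- split; [exact: monoid_to_group1 | exact: monoid_to_groupM].
- apply: (@monoid_to_group_inj _ _ (Lambda r)).
  + exact: bplus_cancellative.
  + exact: Lambda_left.
  + by move=> x; apply/(proj1 Lambda_garside)/gen_divides_Lambda.
- by move=> g; apply: left_fraction; apply: common_right_multiple.
- by move=> g; apply: right_fraction; apply: common_left_multiple.
Qed.

End QuasiGarside.

Theorem theorem3p13 (r : nat) (hr : 2 <= r) :
  [/\ quasi_garside_monoid (Bplus r),
      is_group_of_fractions (@Bplus_to_B r)
    & garside_element (Lambda r)].
Proof.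
split; first exact: bplus_quasi_garside.
  exact: bplus_group_of_fractions.
exact: Lambda_garside.
Qed.
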